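(* Fix $n \geq 1$. The theory $VO_n$ is $\aleph_0$-categorical and has quantifier elimination in the language $\mathcal{L}_n^*$. Moreover, if $M$ is a model of $VO_n$ and $A \subseteq M$, then $acl_{\mathcal{L}_n^*}(A)=dcl_{\mathcal{L}_n^*}(A)=\langle A \rangle= \bigcup_{a \in A} \langle a \rangle$.
   Context: Let $\mathcal{L}_n^*$ be the $(n+1)$-sorted language with sorts $R_0, \ldots, R_n$, binary relation symbols $<_1,\ldots,<_n$ with $<_i$ on sort $R_i$, a constant symbol $0$ of sort $R_0$, and function symbols $f_i: R_0 \to R_i$ and $g_i: R_i \to R_0$ for $i=1,\ldots,n$. $VO_n$ is the $\mathcal{L}_n^*$-theory axiomatized by: (1) each $<_i$ is a dense linear order without endpoints on $R_i$; (2) each $f_i$ is injective; (3) $g_i(x)=f_i^{-1}(x)$ if $x \in f_i(R_0)$ and $g_i(x)=0$ otherwise; (4) $f_i(R_0)$ is $<_i$-dense and $<_i$-co-dense in $R_i$; (5) whenever $a_i <_i b_i$ in $R_i$ for all $i \in\{1,\ldots,n\}$, there is $x_0 \in R_0$ with $a_i <_i f_i(x_0) <_i b_i$ for all $i$. For $A$ a subset of a model $M$ of $VO_n$, $\langle A \rangle$ denotes the $\mathcal{L}_n^*$-substructure generated by $A$; $acl$ and $dcl$ are model-theoretic algebraic and definable closure in $M$.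
   Formalization: The last equality, that ⟨A⟩ is the union of the ⟨a⟩ for a in A, is stated only for nonempty A, since for A = ∅ it fails: ⟨∅⟩ contains the constant 0 while the union is empty; acl(A) = dcl(A) = ⟨A⟩ is stated for every A. *)

(* Defs.v *)
From HB Require Import structures.
From mathcomp Require Import all_boot.
From mathcomp Require Import boolp classical_sets functions cardinality.

Set Implicit Arguments.
Unset Strict Implicit.
Unset Printing Implicit Defensive.

Local Open Scope classical_set_scope.
Local Open Scope card_scope.

(** * Many-sorted first-order logic with equality *)

(** The [i]-th argument of a function symbol [f] has sort [fun_dom i], for
    [i : 'I_(fun_arity f)]; function symbols of arity 0 are the constants. *)
Record language := Language {
  sort : eqType;
  fun_symb : Type;
  fun_arity : fun_symb -> nat;
  fun_dom : forall f : fun_symb, 'I_(fun_arity f) -> sort;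
  fun_cod : fun_symb -> sort;
  rel_symb : Type;
  rel_arity : rel_symb -> nat;
  rel_dom : forall r : rel_symb, 'I_(rel_arity r) -> sort
}.

Arguments fun_dom {l} f _.
Arguments rel_dom {l} r _.

(** As usual in first-order logic, no sort of a structure is empty. *)
Record structure (L : language) := Structure {
  carrier :> sort L -> Type;
  carrier_inhabited : forall s, inhabited (carrier s);
  fun_interp : forall f : fun_symb L,
    (forall i, carrier (fun_dom f i)) -> carrier (fun_cod f);
  rel_interp : forall r : rel_symb L,
    (forall i, carrier (rel_dom r i)) -> Prop
}.

(** Each sort [s] has the variables [(s, k)], [k : nat]. *)
Definition var (L : language) := (sort L * nat)%type.

Inductive term (L : language) : sort L -> Type :=
| Var (x : var L) : term x.1
| App (f : fun_symb L) (ts : forall i, term (fun_dom f i)) : term (fun_cod f).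

Inductive formula (L : language) : Type :=
| Bot
| Equal (s : sort L) (t u : term s)
| Rel (r : rel_symb L) (ts : forall i, term (rel_dom r i))
| Imp (p q : formula L)
| And (p q : formula L)
| Or (p q : formula L)
| All (x : var L) (p : formula L)
| Ex (x : var L) (p : formula L).

Arguments Bot {L}.

Definition Not (L : language) (p : formula L) : formula L := Imp p Bot.
Definition Top (L : language) : formula L := Not Bot.
Arguments Top {L}.

Section Syntax.
Variable L : language.

Fixpoint term_vars (s : sort L) (t : term s) : set (var L) :=
  match t with
  | Var x => [set x]
  | App f ts => \bigcup_i term_vars (ts i)
  end.

Fixpoint free_vars (p : formula L) : set (var L) :=
  match p with
  | Bot => set0
  | Equal _ t u => term_vars t `|` term_vars u
  | Rel r ts => \bigcup_i term_vars (ts i)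
  | Imp p q | And p q | Or p q => free_vars p `|` free_vars q
  | All x p | Ex x p => free_vars p `\ x
  end.

Fixpoint quantifier_free (p : formula L) : Prop :=
  match p with
  | Bot | Equal _ _ _ | Rel _ _ => True
  | Imp p q | And p q | Or p q => quantifier_free p /\ quantifier_free q
  | All _ _ | Ex _ _ => False
  end.

End Syntax.

Section Semantics.
Variables (L : language) (M : structure L).

Definition valuation := forall x : var L, M x.1.

Definition update (v : valuation) (x : var L) (a : M x.1) : valuation :=
  @dfwith (var L) (fun y => M y.1) v x a.

Fixpoint eval (v : valuation) (s : sort L) (t : term s) : M s :=
  match t with
  | Var x => v x
  | App f ts => fun_interp (fun i => eval v (ts i))
  end.

Fixpoint sat (v : valuation) (p : formula L) : Prop :=
  match p with
  | Bot => False
  | Equal _ t u => eval v t = eval v u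
  | Rel r ts => rel_interp (fun i => eval v (ts i))
  | Imp p q => sat v p -> sat v q
  | And p q => sat v p /\ sat v q
  | Or p q => sat v p \/ sat v q
  | All x p => forall a : M x.1, sat (update v a) p
  | Ex x p => exists a : M x.1, sat (update v a) p
  end.

(** Elements of [M] of any sort: the disjoint union of the sorts. *)
Definition elt := {s : sort L & M s}.

Definition mkelt (s : sort L) (a : M s) : elt := existT (fun s => M s) s a.

Definition substructure (B : set elt) : Prop :=
  forall (f : fun_symb L) (a : forall i, M (fun_dom f i)),
    (forall i, B (mkelt (a i))) -> B (mkelt (fun_interp a)).

Definition generated (A : set elt) : set elt := smallest substructure A.

(** [D] is defined by an instance [p(x, b)] of a formula whose free variables
    other than [x] are assigned parameters [b] from [A]. *)
Definition definable_over (A : set elt) (s : sort L) (D : set (M s)) : Prop :=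
  exists (p : formula L) (k : nat) (v : valuation),
    (forall y, free_vars p y -> y <> (s, k) -> A (mkelt (v y))) /\
    D = [set c | sat (@update v (s, k) c) p].

Definition dcl (A : set elt) : set elt :=
  [set a | definable_over A [set projT2 a]].

Definition acl (A : set elt) : set elt :=
  [set a | exists D : set (M (projT1 a)),
     definable_over A D /\ finite_set D /\ D (projT2 a)].

End Semantics.

Definition isomorphic (L : language) (M N : structure L) : Prop :=
  exists h : forall s, M s -> N s,
    (forall s, bijective (@h s)) /\
    (forall (f : fun_symb L) (a : forall i, M (fun_dom f i)),
       h _ (fun_interp a) = fun_interp (fun i => h _ (a i))) /\
    (forall (r : rel_symb L) (a : forall i, M (rel_dom r i)),
       rel_interp a <-> rel_interp (fun i => h _ (a i))).

Section Theories.
Variable L : language.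

Definition models (M : structure L) (T : set (formula L)) : Prop :=
  forall p, T p -> forall v : valuation M, sat v p.

Definition quantifier_elimination (T : set (formula L)) : Prop :=
  forall p : formula L, exists q : formula L,
    quantifier_free q /\ free_vars q `<=` free_vars p /\
    forall (M : structure L) (v : valuation M),
      models M T -> (sat v p <-> sat v q).

(** Exactly one model of cardinality aleph_0 up to isomorphism. *)
Definition aleph0_categorical (T : set (formula L)) : Prop :=
  (exists M : structure L, models M T /\ [set: elt M] #= [set: nat]) /\
  forall M N : structure L,
    models M T -> [set: elt M] #= [set: nat] ->
    models N T -> [set: elt N] #= [set: nat] ->
    isomorphic M N.

End Theories.

(** * The language L_n^* and the theory VO_n *)

(** The indices 1, ..., n are represented by ['I_n]. The sort [R_0] is [None]
    and the sorts [R_1, ..., R_n] are the [Some i]. *)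
Inductive vo_fun (n : nat) : Type :=
| Zero
| Fsymb (i : 'I_n)
| Gsymb (i : 'I_n).

Arguments Zero {n}.

Definition vo_fun_arity (n : nat) (f : vo_fun n) : nat :=
  if f is Zero then 0 else 1.

Definition vo_fun_dom (n : nat) (f : vo_fun n) :
    'I_(vo_fun_arity f) -> option 'I_n :=
  fun _ => if f is Gsymb i then Some i else None.

Definition vo_fun_cod (n : nat) (f : vo_fun n) : option 'I_n :=
  if f is Fsymb i then Some i else None.

(** The relation symbol [i : 'I_n] is the order symbol of the sort [Some i]. *)
Definition Lstar (n : nat) : language :=
  @Language (option 'I_n)
    (vo_fun n) (@vo_fun_arity n) (@vo_fun_dom n) (@vo_fun_cod n)
    'I_n (fun _ => 2) (fun i _ => Some i).

Section VO.
Variable n : nat.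

Local Notation fml := (formula (Lstar n)).
Local Notation tm s := (@term (Lstar n) s).

Definition var0 (k : nat) : var (Lstar n) := (None, k).
Definition vari (i : 'I_n) (k : nat) : var (Lstar n) := (Some i, k).

Definition tvar0 (k : nat) : tm None := Var (var0 k).
Definition tvari (i : 'I_n) (k : nat) : tm (Some i) := Var (vari i k).

Definition tzero : tm None :=
  @App (Lstar n) Zero (fun i : 'I_0 => False_rect _ (notF (ltn_ord i))).
Definition tF (i : 'I_n) (t : tm None) : tm (Some i) :=
  @App (Lstar n) (Fsymb i) (fun _ => t).
Definition tG (i : 'I_n) (t : tm (Some i)) : tm None :=
  @App (Lstar n) (Gsymb i) (fun _ => t).

Definition vo_lt (i : 'I_n) (t u : tm (Some i)) : fml :=
  @Rel (Lstar n) i (fun j : 'I_2 => if j == ord0 then t else u).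

Definition all_seq (xs : seq (var (Lstar n))) (p : fml) : fml :=
  foldr (@All (Lstar n)) p xs.

Inductive VO : set fml :=
| VO_lt_irrefl i : VO
    (All (vari i 0) (Not (vo_lt (tvari i 0) (tvari i 0))))
| VO_lt_trans i : VO
    (all_seq [:: vari i 0; vari i 1; vari i 2]
      (Imp (And (vo_lt (tvari i 0) (tvari i 1)) (vo_lt (tvari i 1) (tvari i 2)))
           (vo_lt (tvari i 0) (tvari i 2))))
| VO_lt_total i : VO
    (all_seq [:: vari i 0; vari i 1]
      (Or (vo_lt (tvari i 0) (tvari i 1))
        (Or (Equal (tvari i 0) (tvari i 1)) (vo_lt (tvari i 1) (tvari i 0)))))
| VO_lt_dense i : VO
    (all_seq [:: vari i 0; vari i 1]
      (Imp (vo_lt (tvari i 0) (tvari i 1))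
        (Ex (vari i 2)
          (And (vo_lt (tvari i 0) (tvari i 2)) (vo_lt (tvari i 2) (tvari i 1))))))
| VO_lt_no_min i : VO
    (All (vari i 0) (Ex (vari i 1) (vo_lt (tvari i 1) (tvari i 0))))
| VO_lt_no_max i : VO
    (All (vari i 0) (Ex (vari i 1) (vo_lt (tvari i 0) (tvari i 1))))
| VO_F_inj i : VO
    (all_seq [:: var0 0; var0 1]
      (Imp (Equal (tF i (tvar0 0)) (tF i (tvar0 1)))
           (Equal (tvar0 0) (tvar0 1))))
| VO_G_image i : VO
    (all_seq [:: vari i 0; var0 0]
      (Imp (Equal (tF i (tvar0 0)) (tvari i 0))
           (Equal (tG (tvari i 0)) (tvar0 0))))
| VO_G_not_image i : VO
    (All (vari i 0)
      (Imp (Not (Ex (var0 0) (Equal (tF i (tvar0 0)) (tvari i 0))))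
           (Equal (tG (tvari i 0)) tzero)))
| VO_F_dense i : VO
    (all_seq [:: vari i 0; vari i 1]
      (Imp (vo_lt (tvari i 0) (tvari i 1))
        (Ex (var0 0)
          (And (vo_lt (tvari i 0) (tF i (tvar0 0)))
               (vo_lt (tF i (tvar0 0)) (tvari i 1))))))
| VO_F_codense i : VO
    (all_seq [:: vari i 0; vari i 1]
      (Imp (vo_lt (tvari i 0) (tvari i 1))
        (Ex (vari i 2)
          (And (Not (Ex (var0 0) (Equal (tF i (tvar0 0)) (tvari i 2))))
            (And (vo_lt (tvari i 0) (tvari i 2)) (vo_lt (tvari i 2) (tvari i 1)))))))
| VO_box : VO
    (all_seq ([seq vari i 0 | i : 'I_n] ++ [seq vari i 1 | i : 'I_n])
      (Imp (\big[@And (Lstar n)/Top]_(i < n) vo_lt (tvari i 0) (tvari i 1))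
        (Ex (var0 0)
          (\big[@And (Lstar n)/Top]_(i < n)
            And (vo_lt (tvari i 0) (tF i (tvar0 0)))
                (vo_lt (tF i (tvar0 0)) (tvari i 1)))))).

End VO.

(* Main.v *)
(** The theory follows from back and forth between models by finite partial
    isomorphisms that are closed under all function symbols. To extend one to a
    new element [a] of [R_0], the finitely many constraints on an image [b] ask
    each [f_i b] to lie in an open interval of [R_i], and the box axiom meets all
    these intervals at once; a new element of [R_i] outside the image of [f_i] is
    matched by co-density, and one inside the image reduces to [R_0].

    Since nested terms collapse, the substructure generated by a finite tuple is
    given by finitely many terms, and its isomorphism type by the order among
    them; hence quantifier elimination. The intervals can be shrunk to avoid any
    finite set of images, so an element outside the generated substructure has
    infinitely many conjugates, which bounds the algebraic closure. *)

Require Import Defs.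
From Stdlib Require List.
From mathcomp Require Import all_boot.
From mathcomp Require Import order ssralg ssrnum rat.
From mathcomp Require Import boolp classical_sets functions cardinality.

Import Order.TTheory GRing.Theory Num.Theory.

Set Implicit Arguments.
Unset Strict Implicit.
Unset Printing Implicit Defensive.

Local Open Scope classical_set_scope.

(** Lists allow induction over the elements of a finite set; [List.In] makes sense over a type
    without decidable equality. *)
Lemma finite_set_listP T (A : set T) :
  finite_set A <-> exists l : seq T, forall x, A x <-> List.In x l.
Proof.
have InP (l : seq {classic T}) (x : {classic T}) : List.In x l <-> x \in l.
  elim: l => [|y l IHl] //=; rewrite inE; split.
    by case=> [->|/IHl ->]; rewrite ?eqxx ?orbT.
  by case/orP => [/eqP ->|/IHl]; [left|right].
split=> [|[l lP]].
  move=> /(@finite_seqP {classic T})[s As]; exists s => x.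
  by rewrite As; apply: iff_sym; exact: InP.
apply/(@finite_seqP {classic T}); exists l.
by apply/seteqP; split=> x; [move=> /lP /InP|move=> /InP /lP].
Qed.

(** * Dense linear orders without endpoints and finite order-preserving relations *)

Section DenseLinearOrder.
Variables (T : Type) (lt : T -> T -> Prop).

Record dlo : Prop := Dlo {
  dlo_irrefl : forall a, ~ lt a a;
  dlo_trans : forall a b c, lt a b -> lt b c -> lt a c;
  dlo_total : forall a b, lt a b \/ a = b \/ lt b a;
  dlo_dense : forall a b, lt a b -> exists c, lt a c /\ lt c b;
  dlo_no_min : forall a, exists b, lt b a;
  dlo_no_max : forall a, exists b, lt a b
}.

Hypothesis ltT : dlo.

Lemma dlo_lower_bound (x0 : T) (B : set T) : finite_set B ->
  exists a, forall b, B b -> lt a b.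
Proof.
move=> /finite_set_listP[l lP].
suff [a aP] : exists a, forall b, List.In b l -> lt a b.
  by exists a => b /lP /aP.
elim: l {B lP} => [|c l [a aP]]; first by exists x0.
have [ac|[ac|ca]] := dlo_total ltT a c.
- by exists a => b /= [<-//|/aP].
- have [d da] := dlo_no_min ltT a.
  exists d => b /= [<-|/aP]; first by rewrite -ac.
  exact: (dlo_trans ltT).
- have [d dc] := dlo_no_min ltT c.
  exists d => b /= [<-//|/aP ab].
  by apply: (dlo_trans ltT) dc _; apply: (dlo_trans ltT) ab.
Qed.

(** Start from a strict lower bound of [B] and raise it to each larger element of [A]. This also
    covers empty [A] or [B]. *)
Lemma dlo_left_endpoint (x0 : T) (A B : set T) : finite_set A -> finite_set B ->
  (forall a b, A a -> B b -> lt a b) ->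
  exists l, (forall b, B b -> lt l b) /\ (forall a, A a -> a = l \/ lt a l).
Proof.
move=> /finite_set_listP[s sP] Bfin AB.
have {}AB a b : List.In a s -> B b -> lt a b by move=> /sP; exact: AB.
suff [l [lB lA]] : exists l, (forall b, B b -> lt l b) /\
    (forall a, List.In a s -> a = l \/ lt a l).
  by exists l; split=> // a /sP /lA.
elim: s AB {sP} => [|c s IHs] AB.
  by have [l lB] := dlo_lower_bound x0 Bfin; exists l.
have [a b|l [lB lA]] := IHs; first by move=> sa; apply: AB; right.
have [lc|[lc|cl]] := dlo_total ltT l c.
- exists c; split=> [b|a /= [<-|/lA[->|al]]]; [|by left|by right|right].
    by apply: AB; left.
  exact: (dlo_trans ltT) al lc.
- by exists l; split=> // a /= [<-|/lA //]; left.
- by exists l; split=> // a /= [<-|/lA //]; right.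
Qed.

Lemma dlo_right_endpoint (l : T) (B : set T) : finite_set B ->
  (forall b, B b -> lt l b) ->
  exists r, lt l r /\ (forall b, B b -> r = b \/ lt r b).
Proof.
move=> /finite_set_listP[s sP] lB.
have {}lB b : List.In b s -> lt l b by move=> /sP; exact: lB.
suff [r [lr rB]] : exists r, lt l r /\
    (forall b, List.In b s -> r = b \/ lt r b).
  by exists r; split=> // b /sP /rB.
elim: s lB {sP} => [|c s IHs] lB.
  by have [r lr] := dlo_no_max ltT l; exists r.
have [b|r [lr rB]] := IHs; first by move=> sb; apply: lB; right.
have [rc|[rc|cr]] := dlo_total ltT r c.
- by exists r; split=> // b /= [<-|/rB //]; right.
- by exists r; split=> // b /= [<-|/rB //]; left.
- exists c; split=> [|b /= [<-|/rB[<-|rb]]]; [|by left|by right|right].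
    by apply: lB; left.
  exact: (dlo_trans ltT) cr rb.
Qed.

(** Whenever a forbidden point lies inside the current interval, the right end is moved down to it;
    finitely many moves remove all of [F]. *)
Lemma dlo_avoid (l r : T) (F : set T) : finite_set F -> lt l r ->
  exists l' r', lt l' r' /\
    forall b, lt l' b -> lt b r' -> lt l b /\ lt b r /\ ~ F b.
Proof.
move=> /finite_set_listP[s sP] lr.
suff [l' [r' [lr' H]]] : exists l' r', lt l' r' /\
    forall b, lt l' b -> lt b r' -> lt l b /\ lt b r /\ ~ List.In b s.
  by exists l', r'; split=> // b lb br; rewrite sP; exact: H.
elim: s {sP} => [|c s [l' [r' [lr' H]]]].
  by exists l, r; split=> // b lb br; split=> //; split=> // -[].
have [lc|lc] := pselect (lt l' c); last first.
  exists l', r'; split=> // b lb br; have [? [? ?]] := H b lb br.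
  by do 2![split=> //]; move=> /= [cb|//]; apply: lc; rewrite cb.
have [cr|cr] := pselect (lt c r').
  exists l', c; split=> // b lb bc.
  have [|? [? ?]] := H b lb; first exact: (dlo_trans ltT) bc cr.
  do 2![split=> //]; move=> /= [cb|//].
  by move: bc; rewrite cb => /(dlo_irrefl ltT).
exists l', r'; split=> // b lb br; have [? [? ?]] := H b lb br.
by do 2![split=> //]; move=> /= [cb|//]; apply: cr; rewrite cb.
Qed.

Lemma dlo_interval (x0 : T) (A B F : set T) :
  finite_set A -> finite_set B -> finite_set F ->
  (forall a b, A a -> B b -> lt a b) ->
  exists l r, lt l r /\ forall c, lt l c -> lt c r ->
    (forall a, A a -> lt a c) /\ (forall b, B b -> lt c b) /\ ~ F c.
Proof.
move=> Afin Bfin Ffin AB.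
have [l0 [lB lA]] := dlo_left_endpoint x0 Afin Bfin AB.
have [r0 [lr rB]] := dlo_right_endpoint Bfin lB.
have [l [r [lr' H]]] := dlo_avoid Ffin lr.
exists l, r; split=> // c lc cr; have [lc0 [cr0 Fc]] := H c lc cr.
split=> [a /lA[->//|al]|]; first exact: (dlo_trans ltT) al lc0.
by split=> // b /rB[<-//|rb]; exact: (dlo_trans ltT) cr0 rb.
Qed.

End DenseLinearOrder.

(** Stated for relations so that partial maps need no domain. Between strict linear orders it makes
    the relation single-valued and injective. *)
Definition order_preserving T U (ltT : T -> T -> Prop) (ltU : U -> U -> Prop)
    (R : T -> U -> Prop) :=
  forall a a' b b', R a b -> R a' b' -> (ltT a a' <-> ltU b b').

(** The partners of elements below [a] lie below the partners of elements above [a], so a whole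
    interval separates the two finite sets. Each of its points has the same position as [a], and
    shrinking it avoids [F]. *)
Lemma dlo_cut T U (ltT : T -> T -> Prop) (ltU : U -> U -> Prop)
    (R : T -> U -> Prop) (u0 : U) (a : T) (F : set U) :
  dlo ltT -> dlo ltU -> order_preserving ltT ltU R ->
  finite_set [set p : T * U | R p.1 p.2] -> finite_set F ->
  (forall b, ~ R a b) ->
  exists l r, ltU l r /\ forall b, ltU l b -> ltU b r ->
    order_preserving ltT ltU (fun c d => R c d \/ c = a /\ d = b) /\ ~ F b.
Proof.
move=> dT dU Rlt Rfin Ffin Ra.
pose A := [set d | exists c, R c d /\ ltT c a].
pose B := [set d | exists c, R c d /\ ltT a c].
have im_fin (C : set U) : (forall d, C d -> exists c, R c d) -> finite_set C.
  move=> CR; apply: sub_finite_set (finite_image snd Rfin) => d /CR[c cd].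
  by exists (c, d).
have [||//|d d' [c [cd ca]] [c' [cd' ca']]|l [r [lr H]]] :=
    @dlo_interval U ltU dU u0 A B F.
- by apply: im_fin => d [c [? _]]; exists c.
- by apply: im_fin => d [c [? _]]; exists c.
- by apply/(Rlt _ _ _ _ cd cd'); exact: (dlo_trans dT) ca ca'.
exists l, r; split=> // b lb br; have [Ab [bB Fb]] := H b lb br.
have nsymT x y : ltT x y -> ~ ltT y x.
  by move=> xy /(dlo_trans dT xy) /(dlo_irrefl dT).
have nsymU x y : ltU x y -> ~ ltU y x.
  by move=> xy /(dlo_trans dU xy) /(dlo_irrefl dU).
have pos c d : R c d -> (ltT c a /\ ltU d b) \/ (ltT a c /\ ltU b d).
  move=> cd; have [ca|[ca|ac]] := dlo_total dT c a.
  - by left; split=> //; apply: Ab; exists c.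
  - by exfalso; apply: (Ra d); rewrite -ca.
  - by right; split=> //; apply: bB; exists c.
split=> // c c' d d' [cd|[-> ->]] [cd'|[-> ->]].
- exact: Rlt.
- by have [[]|[/nsymT ? /nsymU ?]] := pos _ _ cd.
- by have [[/nsymT ? /nsymU ?]|[]] := pos _ _ cd'.
- by split=> [/(dlo_irrefl dT)|/(dlo_irrefl dU)].
Qed.

(** * Valuations, free variables and generated substructures *)

Section FirstOrderLogic.
Variable L : language.

Lemma update_same (M : structure L) (v : valuation M) x (a : M x.1) :
  @update L M v x a x = a.
Proof. exact: (@dfwith_in _ (fun y : var L => M y.1)). Qed.

Lemma update_other (M : structure L) (v : valuation M) x (a : M x.1) y :
  x != y -> @update L M v x a y = v y.
Proof. exact: (@dfwith_out _ (fun y : var L => M y.1)). Qed.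

(** Equality of dependent pairs gives equality of second components because the sorts form an
    [eqType], where proofs of [s = s] are unique. *)
Lemma mkelt_inj (M : structure L) s : injective (@mkelt L M s).
Proof.
move=> a b ab; have := congr1 (fun e : elt M =>
  if pselect (projT1 e = s) is left es then
    Some (ecast s (M s) es (projT2 e)) else None) ab.
by rewrite /=; case: pselect => // e []; rewrite !eq_axiomK.
Qed.

Lemma valuation_inhabited (M : structure L) : inhabited (valuation M).
Proof.
have inh s : {a : M s | True}.
  by apply: cid; have [a] := carrier_inhabited M s; exists a.
by constructor=> x; exact: sval (inh x.1).
Qed.

Lemma finite_term_vars s (t : @term L s) : finite_set (term_vars t).
Proof.
elim: t => [x|f ts IH] /=; first exact: finite_set1.
by apply: bigcup_finite => // i _; exact: IH.
Qed.

Lemma finite_free_vars (p : formula L) : finite_set (free_vars p).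
Proof.
elim: p => [|s t u|r ts|p IHp q IHq|p IHp q IHq|p IHp q IHq|x p IHp|x p IHp] //=.
- by rewrite finite_setU; split; exact: finite_term_vars.
- by apply: bigcup_finite => // i _; exact: finite_term_vars.
- by rewrite finite_setU.
- by rewrite finite_setU.
- by rewrite finite_setU.
- exact: finite_setD.
- exact: finite_setD.
Qed.

Lemma eval_ext (M : structure L) (v w : valuation M) s (t : term s) :
  (forall y, term_vars t y -> v y = w y) -> eval v t = eval w t.
Proof.
elim: t => [x|f ts IH] /= vw; first exact: vw.
congr fun_interp; apply: functional_extensionality_dep => i.
by apply: IH => y ty; apply: vw; exists i.
Qed.

Lemma sub_generated (M : structure L) (A : set (elt M)) : A `<=` generated A.
Proof. exact: sub_gen_smallest. Qed.

Lemma generated_substructure (M : structure L) (A : set (elt M)) :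
  substructure (generated A).
Proof. by move=> f a Aa B BA; apply: BA.1 => i; exact: Aa i B BA. Qed.

Lemma generated_eval (M : structure L) (A : set (elt M)) (v : valuation M)
    s (t : term s) :
  (forall y, term_vars t y -> A (mkelt (v y))) -> generated A (mkelt (eval v t)).
Proof.
elim: t => [x|f ts IH] /= vA; first by apply: sub_generated; exact: vA.
by apply: generated_substructure => i; apply: IH => y ty; apply: vA; exists i.
Qed.

Lemma dcl_sub_acl (M : structure L) (A : set (elt M)) : dcl A `<=` acl A.
Proof.
by move=> a aA; exists [set projT2 a].
Qed.

(** ** Quantifier elimination from finitely many atomic formulas *)

(** A property depending only on the truth values of the formulas in [Phi] is a Boolean combination
    of them. The induction splits on the truth value of one formula at a time. *)
Lemma determined_by_quantifier_free (T : set (formula L)) (X : set (var L))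
    (Phi : seq (formula L)) (K : forall M : structure L, valuation M -> Prop) :
  (forall p, List.In p Phi -> quantifier_free p /\ free_vars p `<=` X) ->
  (forall M (v : valuation M) N (w : valuation N), models M T -> models N T ->
     (forall p, List.In p Phi -> (sat v p <-> sat w p)) -> K M v -> K N w) ->
  exists q, quantifier_free q /\ free_vars q `<=` X /\
    forall M (v : valuation M), models M T -> (K M v <-> sat v q).
Proof.
elim: Phi K => [|p Phi IH] K PhiX PhiK.
  (* With no formulas left, [K] holds under every valuation in every model of [T] or under none, so
     it is [Top] or [Bot]. *)
  have [[M [v [MT Kv]]]|nK] :=
      pselect (exists M (v : valuation M), models M T /\ K M v).
    exists Top; split=> //; split=> [y /= []//|N w NT].
    split=> [_ []|_]; exact: (PhiK M v N w MT NT _ Kv).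
  exists Bot; split=> //; split=> // N w NT.
  by split=> // Kw; apply: nK; exists N, w.
have [pqf pX] : quantifier_free p /\ free_vars p `<=` X by apply: PhiX; left.
(* [K' b] asks for some realization of [K] in which [p] has truth value [b] and which agrees with
   [v] on [Phi]; it depends on [Phi] alone. *)
pose K' (b : Prop) (M : structure L) (v : valuation M) :=
  exists N (w : valuation N), models N T /\ K N w /\ (sat w p <-> b) /\
    forall r, List.In r Phi -> (sat v r <-> sat w r).
have K'P b : exists q, quantifier_free q /\ free_vars q `<=` X /\
    forall M (v : valuation M), models M T -> (K' b M v <-> sat v q).
  apply: IH => [r rPhi|M v N w MT NT vw [N' [w' [N'T [Kw' [w'b vw']]]]]].
    by apply: PhiX; right.
  exists N', w'; do 3![split=> //] => r rPhi.
  by split=> [/(vw r rPhi)/(vw' r rPhi)|/(vw' r rPhi)/(vw r rPhi)].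
have [q1 [q1qf [q1X q1P]]] := K'P True.
have [q0 [q0qf [q0X q0P]]] := K'P False.
exists (Or (And p q1) (And (Not p) q0)); split; first by [].
split=> [y /= [[|]|[[|[]]|]]|M v MT /=]; [exact: pX|exact: q1X|exact: pX|exact: q0X|].
rewrite -q1P // -q0P //; split.
  move=> Kv; have [pv|pv] := pselect (sat v p); [left|right].
    by split=> //; exists M, v.
  by split=> //; exists M, v.
case=> -[pv [N [w [NT [Kw [pw vw]]]]]].
  apply: (PhiK N w M v NT MT _ Kw) => r /= [<-|/vw]; first by rewrite pw.
  exact: iff_sym.
apply: (PhiK N w M v NT MT _ Kw) => r /= [<-|/vw]; first by rewrite pw.
exact: iff_sym.
Qed.

(** ** Back and forth *)

(** Closure under all function symbols, constants included, makes domain and range substructures, so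
    these are isomorphisms between substructures that are finite in each sort. *)
Record finite_partial_iso (M N : structure L) (P : forall s, M s -> N s -> Prop) :
  Prop := FinitePartialIso {
  fpi_fun : forall f (a : forall i, M (fun_dom f i)) (b : forall i, N (fun_dom f i)),
    (forall i, P _ (a i) (b i)) -> P _ (fun_interp a) (fun_interp b);
  fpi_rel : forall r (a : forall i, M (rel_dom r i)) (b : forall i, N (rel_dom r i)),
    (forall i, P _ (a i) (b i)) -> (rel_interp a <-> rel_interp b);
  fpi_eq : forall s (a a' : M s) (b b' : N s),
    P s a b -> P s a' b' -> (a = a' <-> b = b');
  fpi_finite : forall s, finite_set [set p : M s * N s | P s p.1 p.2]
}.

(** This is the forth half; the back half is the same property with [M] and [N] exchanged, read
    through converse relations. *)
Definition extension_property (M N : structure L) :=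
  forall P : forall s, M s -> N s -> Prop, finite_partial_iso P ->
  forall s (a : M s), exists Q : forall s, M s -> N s -> Prop,
    finite_partial_iso Q /\ (forall s c d, P s c d -> Q s c d) /\
    exists b, Q s a b.

Lemma finite_partial_iso_converse (M N : structure L)
    (P : forall s, M s -> N s -> Prop) :
  finite_partial_iso P -> @finite_partial_iso N M (fun s b a => P s a b).
Proof.
case=> Pf Pr Pe Pfin; split=> [f b a ab|r b a ab|s b b' a a' ab ab'|s].
- exact: (Pf f a b ab).
- exact: iff_sym (Pr r a b ab).
- exact: iff_sym (Pe s a a' b b' ab ab').
- apply: sub_finite_set (finite_image (fun p => (p.2, p.1)) (Pfin s)).
  by case=> b a /= ab; exists (a, b).
Qed.

Lemma extension_converse (M N : structure L) : extension_property N M ->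
  forall P : forall s, M s -> N s -> Prop, finite_partial_iso P ->
  forall s (b : N s), exists Q : forall s, M s -> N s -> Prop,
    finite_partial_iso Q /\ (forall s c d, P s c d -> Q s c d) /\
    exists a, Q s a b.
Proof.
move=> NM P /finite_partial_iso_converse fP s b.
have [Q [fQ [PQ [a ab]]]] := NM _ fP s b.
exists (fun s c d => Q s d c); split.
  exact: finite_partial_iso_converse.
by split=> [s' c d cd|]; [exact: PQ|exists a].
Qed.

Lemma finite_partial_iso_eval (M N : structure L)
    (P : forall s, M s -> N s -> Prop) (v : valuation M) (w : valuation N)
    s (t : term s) :
  finite_partial_iso P -> (forall y, term_vars t y -> P _ (v y) (w y)) ->
  P s (eval v t) (eval w t).
Proof.
move=> fP; elim: t => [x|f ts IH] /= vw; first exact: vw.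
by apply: (fpi_fun fP) => i; apply: IH => y ty; apply: vw; exists i.
Qed.

Lemma update_related (M N : structure L) (P Q : forall s, M s -> N s -> Prop)
    (X : set (var L)) (v : valuation M) (w : valuation N) x (a : M x.1) (b : N x.1) :
  (forall s c d, P s c d -> Q s c d) -> Q _ a b ->
  (forall y, (X `\ x) y -> P _ (v y) (w y)) ->
  forall y, X y -> Q _ (@update L M v x a y) (@update L N w x b y).
Proof.
move=> PQ ab vw y py; have [xy|xy] := eqVneq x y.
  by case: y / xy py => _; rewrite !update_same.
rewrite !update_other //; apply/PQ/vw; split=> // yx.
by move: xy; rewrite yx eqxx.
Qed.

(** Induction on the formula with [P] varying: at a quantifier, forth supplies the partner of a
    witness from [M] and back the partner of one from [N]. *)
Lemma finite_partial_iso_sat (M N : structure L) :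
  extension_property M N -> extension_property N M ->
  forall (p : formula L) (P : forall s, M s -> N s -> Prop)
    (v : valuation M) (w : valuation N), finite_partial_iso P ->
  (forall y, free_vars p y -> P _ (v y) (w y)) -> (sat v p <-> sat w p).
Proof.
move=> MN /extension_converse NM.
elim=> [|s t u|r ts|p IHp q IHq|p IHp q IHq|p IHp q IHq|x p IHp|x p IHp]
    P v w fP /= vw; first by [].
- by apply: (fpi_eq fP); apply: finite_partial_iso_eval => // y ty;
    apply: vw; [left|right].
- apply: (fpi_rel fP) => i; apply: finite_partial_iso_eval => // y ty.
  by apply: vw; exists i.
- by rewrite (IHp P v w) // ?(IHq P v w) // => y py; apply: vw; [right|left].
- by rewrite (IHp P v w) // ?(IHq P v w) // => y py; apply: vw; [right|left].
- by rewrite (IHp P v w) // ?(IHq P v w) // => y py; apply: vw; [right|left].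
- split=> H c.
    have [Q [fQ [PQ [b bc]]]] := NM P fP _ c.
    by apply/(IHp Q _ _ fQ (update_related PQ bc vw)); exact: H.
  have [Q [fQ [PQ [b cb]]]] := MN P fP _ c.
  by apply/(IHp Q _ _ fQ (update_related PQ cb vw)); exact: H.
- split=> -[c H].
    have [Q [fQ [PQ [b cb]]]] := MN P fP _ c.
    by exists b; apply/(IHp Q _ _ fQ (update_related PQ cb vw)).
  have [Q [fQ [PQ [b bc]]]] := NM P fP _ c.
  by exists b; apply/(IHp Q _ _ fQ (update_related PQ bc vw)).
Qed.

Lemma back_and_forth_quantifier_elimination (T : set (formula L)) :
  (forall M N, models M T -> models N T -> extension_property M N) ->
  (forall X : set (var L), finite_set X ->
     exists Phi : seq (formula L),
     (forall p, List.In p Phi -> quantifier_free p /\ free_vars p `<=` X) /\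
     forall M (v : valuation M) N (w : valuation N), models M T -> models N T ->
       (forall p, List.In p Phi -> (sat v p <-> sat w p)) ->
     exists P : forall s, M s -> N s -> Prop, finite_partial_iso P /\
       forall y, X y -> P _ (v y) (w y)) ->
  quantifier_elimination T.
Proof.
move=> Text Ttypes p.
have [Phi [PhiX PhiP]] := Ttypes _ (finite_free_vars p).
apply: (@determined_by_quantifier_free T _ Phi (fun M v => sat v p)) => //.
move=> M v N w MT NT vw.
have [P [fP Pvw]] := PhiP M v N w MT NT vw.
by have [] := finite_partial_iso_sat (Text _ _ MT NT) (Text _ _ NT MT) fP Pvw.
Qed.

Lemma countable_enumeration (M : structure L) :
  ([set: elt M] #= [set: nat])%card ->
  exists e : nat -> elt M, forall x, exists k, e k = x.
Proof.
move=> /card_set_bijP[f [_ finj fsurj]].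
have /choice[e eP] : forall k, exists x, f x = k.
  by move=> k; have [//|x _ <-] := fsurj k; exists x.
by exists e => x; exists (f x); apply: finj; rewrite ?in_setT ?eP.
Qed.

(** Both structures are enumerated; stage [k] gives the [k]-th element of [M] an image and the
    [k]-th element of [N] a preimage. The union of the stages is the graph of an isomorphism. *)
Lemma countable_isomorphic (M N : structure L)
    (P0 : forall s, M s -> N s -> Prop) :
  ([set: elt M] #= [set: nat])%card -> ([set: elt N] #= [set: nat])%card ->
  extension_property M N -> extension_property N M -> finite_partial_iso P0 ->
  isomorphic M N.
Proof.
move=> /countable_enumeration[eM eMP] /countable_enumeration[eN eNP].
move=> MN /extension_converse NM fP0.
pose fpi := {P : forall s, M s -> N s -> Prop | finite_partial_iso P}.
have /choice[step stepP] : forall Pk : fpi * nat, exists Q : fpi,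
    (forall s c d, sval Pk.1 s c d -> sval Q s c d) /\
    (exists b, sval Q _ (projT2 (eM Pk.2)) b) /\
    (exists a, sval Q _ a (projT2 (eN Pk.2))).
  move=> [[P fP] k] /=.
  have [Q [fQ [PQ [b Qb]]]] := MN P fP _ (projT2 (eM k)).
  have [R [fR [QR [a Ra]]]] := NM Q fQ _ (projT2 (eN k)).
  exists (exist _ R fR); split=> [s c d cd|/=]; first exact/QR/PQ.
  by split; [exists b; exact: QR|exists a].
pose chain := fix chain k : fpi :=
  if k is k'.+1 then step (chain k', k') else exist _ P0 fP0.
have chain_mono k l s c d : (k <= l)%N ->
    sval (chain k) s c d -> sval (chain l) s c d.
  move=> kl; rewrite -(subnK kl); elim: (_ - _)%N => // m IHm cd.
  by rewrite addSn /=; apply: (stepP (_, _)).1; exact: IHm.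
pose U s c d := exists k, sval (chain k) s c d.
have U_total s (a : M s) : exists b, U s a b.
  have [k ka] := eMP (mkelt a).
  by have [_ [[]]] := stepP (chain k, k); rewrite /= ka => b ab _; exists b, k.+1.
have U_surj s (b : N s) : exists a, U s a b.
  have [k kb] := eNP (mkelt b).
  by have [_ [_ []]] := stepP (chain k, k); rewrite /= kb => a ab; exists a, k.+1.
(* Since the chain increases, finitely many pairs of the union already lie in one stage. This treats
   all arguments of a symbol at once. *)
have U_family (I : finType) (s : I -> Defs.sort L) (a : forall i, M (s i))
    (b : forall i, N (s i)) : (forall i, U _ (a i) (b i)) ->
    exists k, forall i, sval (chain k) _ (a i) (b i).
  move=> /choice[k kP]; exists (\max_i k i) => i.
  by apply: chain_mono (kP i); exact: leq_bigmax.
have U_eq s (a a' : M s) (b b' : N s) : U s a b -> U s a' b' -> (a = a' <-> b = b').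
  move=> [k ab] [l ab']; apply: (fpi_eq (svalP (chain (maxn k l)))).
    by apply: chain_mono ab; exact: leq_maxl.
  by apply: chain_mono ab'; exact: leq_maxr.
pose h s a := sval (cid (U_total s a)).
have hP s a : U s a (h s a) by exact: svalP (cid (U_total s a)).
exists h; split=> [s|].
  exists (fun b => sval (cid (U_surj s b))) => [a|b].
    case: cid => a' /= ab; exact: (U_eq _ _ _ _ _ ab (hP s a)).2.
  case: cid => a /= ab; exact: (U_eq _ _ _ _ _ (hP s a) ab).1.
split=> [f a|r a].
  have [i|k ak] := @U_family _ _ a (fun i => h _ (a i)); first exact: hP.
  have := fpi_fun (svalP (chain k)) ak => {}ak.
  exact: (U_eq _ _ _ _ _ (hP _ (fun_interp a)) (ex_intro _ k ak)).1.
have [i|k ak] := @U_family _ _ a (fun i => h _ (a i)); first exact: hP.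
exact: (fpi_rel (svalP (chain k)) ak).
Qed.

End FirstOrderLogic.

(** * The axioms of VO_n read in a structure *)

Section VO.
Variable n : nat.
Implicit Types (M N : structure (Lstar n)) (i : 'I_n).

Definition zM M : M None :=
  @fun_interp (Lstar n) M Zero (fun i : 'I_0 => False_rect _ (notF (ltn_ord i))).
Definition fM M i (x : M None) : M (Some i) :=
  @fun_interp (Lstar n) M (Fsymb i) (fun=> x).
Definition gM M i (c : M (Some i)) : M None :=
  @fun_interp (Lstar n) M (Gsymb i) (fun=> c).
Definition ltM M i (a b : M (Some i)) : Prop :=
  @rel_interp (Lstar n) M i (fun j : 'I_2 => if j == ord0 then a else b).

Arguments zM : clear implicits.

(** Injectivity of each [f_i] is contained in [vo_gf], which provides a left inverse. *)
Record vo_axioms M : Prop := VOAxioms {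
  vo_dlo : forall i, dlo (@ltM M i);
  vo_gf : forall i (x : M None), gM (fM i x) = x;
  vo_g_zero : forall i (c : M (Some i)), (forall x, fM i x <> c) -> gM c = zM M;
  vo_f_dense : forall i (a b : M (Some i)), ltM a b ->
    exists x, ltM a (fM i x) /\ ltM (fM i x) b;
  vo_f_codense : forall i (a b : M (Some i)), ltM a b ->
    exists c, (forall x, fM i x <> c) /\ ltM a c /\ ltM c b;
  vo_f_box : forall a b : forall i, M (Some i), (forall i, ltM (a i) (b i)) ->
    exists x, forall i, ltM (a i) (fM i x) /\ ltM (fM i x) (b i)
}.

(** Arguments are functions on an ordinal type, so a family is identified with its canonical form
    only by extensionality; this lemma and the next three do so for each kind of symbol. *)
Lemma fun_interp_zero M (a : forall j, M (@fun_dom (Lstar n) Zero j)) :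
  @fun_interp (Lstar n) M Zero a = zM M.
Proof.
by congr fun_interp; apply: functional_extensionality_dep => -[].
Qed.

Lemma fun_interp_F M i (a : forall j, M (@fun_dom (Lstar n) (Fsymb i) j)) :
  @fun_interp (Lstar n) M (Fsymb i) a = fM i (a ord0).
Proof.
by congr fun_interp; apply: functional_extensionality_dep => j; rewrite [j]ord1.
Qed.

Lemma fun_interp_G M i (a : forall j, M (@fun_dom (Lstar n) (Gsymb i) j)) :
  @fun_interp (Lstar n) M (Gsymb i) a = gM (a ord0 : M (Some i)).
Proof.
by congr fun_interp; apply: functional_extensionality_dep => j; rewrite [j]ord1.
Qed.

Lemma rel_interp_lt M i (a : forall j, M (@rel_dom (Lstar n) i j)) :
  @rel_interp (Lstar n) M i a = ltM (a ord0 : M (Some i)) (a ord_max).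
Proof.
congr rel_interp; apply: functional_extensionality_dep => j.
by case: (j =P ord0) => [->//|/eqP]; case: j => -[|[]]// lt2 _;
  congr (a _); apply: val_inj.
Qed.

Lemma sat_lt M (v : valuation M) i (t u : @term (Lstar n) (Some i)) :
  @rel_interp (Lstar n) M i (fun j : 'I_2 => eval v (if j == ord0 then t else u)) =
  ltM (eval v t) (eval v u).
Proof. by rewrite rel_interp_lt. Qed.

Lemma eval_tF M (v : valuation M) i t : eval v (tF i t) = fM i (eval v t).
Proof. by []. Qed.

Lemma eval_tG M (v : valuation M) i (t : @term (Lstar n) (Some i)) :
  eval v (tG t) = gM (eval v t).
Proof. by []. Qed.

Lemma eval_tzero M (v : valuation M) : eval v (tzero n) = zM M.
Proof. exact: fun_interp_zero. Qed.

(** Truth under all valuations is unchanged by universal closure: instantiating [x] by its own value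
    [v x] gives back [v]. *)
Lemma sat_all_seq M xs (p : formula (Lstar n)) :
  (forall v : valuation M, sat v (all_seq xs p)) <->
  (forall v : valuation M, sat v p).
Proof.
elim: xs => [|x xs IH] //=; rewrite -IH; split=> [H v|H v a]; last exact: H.
suff <- : @update _ M v x (v x) = v by exact: H.
apply: functional_extensionality_dep => y; have [xy|xy] := eqVneq x y.
  by case: y / xy; rewrite update_same.
by rewrite update_other.
Qed.

Lemma sat_big_And M (v : valuation M) (p : 'I_n -> formula (Lstar n)) :
  sat v (\big[@And (Lstar n)/Top]_i p i) <-> forall i, sat v (p i).
Proof.
suff H (s : seq 'I_n) : sat v (\big[@And (Lstar n)/Top]_(i <- s) p i) <->
    forall i, i \in s -> sat v (p i).
  by rewrite H; split=> pi i => [|_]; apply: pi; rewrite ?mem_index_enum.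
elim: s => [|i s IH]; first by rewrite big_nil /=; split=> //= _ [].
rewrite big_cons /= IH; split=> [[pi ps] j|ps].
  by rewrite inE => /orP[/eqP ->|/ps].
by split=> [|j js]; apply: ps; rewrite inE ?eqxx ?js ?orbT.
Qed.

Lemma exists_valuation M i (a : nat -> M (Some i)) (x : nat -> M None) :
  exists v : valuation M,
    (forall k, v (vari i k) = a k) /\ (forall k, v (var0 n k) = x k).
Proof.
have [v] := valuation_inhabited M.
pose c := @dfwith _ (fun j => nat -> M (Some j)) (fun j k => v (vari j k)) i a.
exists (fun y => match y.1 as s return M s with
                 | None => x y.2 | Some j => c j y.2 end).
by split=> // k /=; rewrite /c dfwith_in.
Qed.

Lemma update_vari M (v : valuation M) i k l (a : M (Some i)) : k != l ->
  @update _ M v (vari i k) a (vari i l) = v (vari i l).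
Proof. by move=> kl; rewrite update_other // xpair_eqE negb_and kl orbT. Qed.

Lemma update_var0 M (v : valuation M) i k l (x : M None) :
  @update _ M v (var0 n k) x (vari i l) = v (vari i l).
Proof. exact: update_other. Qed.

Lemma models_VO M : models M (@VO n) <-> vo_axioms M.
Proof.
split=> [MT|MA].
  have sat_body xs p : VO (all_seq xs p) -> forall v : valuation M, sat v p.
    by move=> /MT; rewrite sat_all_seq.
  have [v0] := valuation_inhabited M; pose x0 := v0 (var0 n 0).
  have ltP i : dlo (@ltM M i).
    split=> [a|a b c|a b|a b|a|a].
    - have [v [va _]] := exists_valuation (fun=> a) (fun=> x0).
      by have /= := sat_body [:: vari i 0] _ (VO_lt_irrefl i) v; rewrite !sat_lt /= va.
    - have [v [va _]] := exists_valuation (nth a [:: a; b; c]) (fun=> x0).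
      have /= := sat_body [:: _; _; _] _ (VO_lt_trans i) v.
      by rewrite !sat_lt /= !va /= => H ab bc; apply: H.
    - have [v [va _]] := exists_valuation (nth a [:: a; b]) (fun=> x0).
      have /= := sat_body [:: _; _] _ (VO_lt_total i) v.
      by rewrite !sat_lt /= !va /=.
    - have [v [va _]] := exists_valuation (nth a [:: a; b]) (fun=> x0).
      have /= := sat_body [:: _; _] _ (VO_lt_dense i) v.
      rewrite !sat_lt /= !va /= => H ab; have [c] := H ab.
      by rewrite !sat_lt /= update_same !update_vari // !va; exists c.
    - have [v [va _]] := exists_valuation (fun=> a) (fun=> x0).
      have /= [b] := sat_body [:: _] _ (VO_lt_no_min i) v.
      by rewrite !sat_lt /= update_same !update_vari // !va; exists b.
    - have [v [va _]] := exists_valuation (fun=> a) (fun=> x0).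
      have /= [b] := sat_body [:: _] _ (VO_lt_no_max i) v.
      by rewrite !sat_lt /= update_same !update_vari // !va; exists b.
  split=> // [i x|i c nc|i a b ab|i a b ab|a b ab].
  - have [v [va vx]] := exists_valuation (fun=> fM i x) (fun=> x).
    have /= := sat_body [:: _; _] _ (VO_G_image i) v.
    by rewrite fun_interp_F fun_interp_G va vx; apply.
  - have [v [va vx]] := exists_valuation (fun=> c) (fun=> x0).
    have /= := sat_body [:: _] _ (VO_G_not_image i) v.
    rewrite fun_interp_zero fun_interp_G /= va; apply=> -[x].
    by rewrite fun_interp_F /= update_same update_var0 va => /nc.
  - have [v [va _]] := exists_valuation (nth a [:: a; b]) (fun=> x0).
    have /= := sat_body [:: _; _] _ (VO_F_dense i) v.
    rewrite !sat_lt /= !va => /(_ ab)[x].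
    by rewrite !sat_lt /= !fun_interp_F update_same !update_var0 !va; exists x.
  - have [v [va _]] := exists_valuation (nth a [:: a; b]) (fun=> x0).
    have /= := sat_body [:: _; _] _ (VO_F_codense i) v.
    rewrite !sat_lt /= !va => /(_ ab)[c].
    rewrite !sat_lt /= update_same !update_vari // !va => -[nc ac].
    exists c; split=> // x xc; apply: nc; exists x.
    by rewrite fun_interp_F /= update_same update_var0 update_same.
  (* One valuation holds all endpoints of the box: index 0 of each sort [R_j] takes the value [a j],
     every other index [b j]. *)
  - pose v : valuation M := fun y => match y.1 as s return M s with
      | None => x0 | Some j => if y.2 == 0%N then a j else b j end.
    have := sat_body _ _ (VO_box n) v; rewrite /= sat_big_And.
    case=> [i|x]; first by rewrite /= sat_lt; exact: ab.
    rewrite sat_big_And => xP; exists x => i.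
    by have /= := xP i; rewrite !sat_lt /= !fun_interp_F update_same !update_var0.
have lt_dlo i := vo_dlo MA i.
move=> p; case=> [i|i|i|i|i|i|i|i|i|i|i|].
- apply/(sat_all_seq M [:: _]) => v.
  by rewrite /= sat_lt; exact: (dlo_irrefl (lt_dlo i)).
- apply/sat_all_seq => v.
  by rewrite /= !sat_lt => -[]; exact: (dlo_trans (lt_dlo i)).
- apply/sat_all_seq => v.
  by rewrite /= !sat_lt; exact: (dlo_total (lt_dlo i)).
- apply/sat_all_seq => v.
  rewrite /= !sat_lt => /(dlo_dense (lt_dlo i))[c cP]; exists c.
  by rewrite !sat_lt /= update_same !update_vari.
- apply/(sat_all_seq M [:: _]) => v.
  have [c cP] := dlo_no_min (lt_dlo i) (v (vari i 0)); exists c.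
  by rewrite /= !sat_lt /= update_same !update_vari.
- apply/(sat_all_seq M [:: _]) => v.
  have [c cP] := dlo_no_max (lt_dlo i) (v (vari i 0)); exists c.
  by rewrite /= !sat_lt /= update_same !update_vari.
- apply/sat_all_seq => v.
  by rewrite /= !fun_interp_F /= => /(congr1 (@gM M i)); rewrite !(vo_gf MA).
- apply/sat_all_seq => v.
  by rewrite /= fun_interp_F fun_interp_G /= => <-; exact: (vo_gf MA).
- apply/(sat_all_seq M [:: _]) => v.
  rewrite /= fun_interp_G fun_interp_zero /= => nc; apply: (vo_g_zero MA) => x xc.
  by apply: nc; exists x; rewrite fun_interp_F /= update_same update_var0.
- apply/sat_all_seq => v.
  rewrite /= !sat_lt => /(vo_f_dense MA)[x xP]; exists x.
  by rewrite !sat_lt /= !fun_interp_F update_same !update_var0.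
- apply/sat_all_seq => v.
  rewrite /= !sat_lt => /(vo_f_codense MA)[c [nc cP]]; exists c.
  rewrite !sat_lt /= update_same !update_vari //; split=> // -[x].
  by rewrite fun_interp_F /= update_same update_var0 update_same => /nc.
- apply/sat_all_seq => v.
  rewrite /= sat_big_And => ab.
  have [i|x xP] := vo_f_box MA (a := fun i => v (vari i 0))
    (b := fun i => v (vari i 1)); first by have := ab i; rewrite /= sat_lt.
  exists x; rewrite sat_big_And => i /=.
  by rewrite !sat_lt /= !fun_interp_F update_same !update_var0.
Qed.

(** ** Extending finite partial isomorphisms *)

Lemma fpi_zero M N (P : forall s, M s -> N s -> Prop) :
  finite_partial_iso P -> P None (zM M) (zM N).
Proof. by move=> fP; apply: (fpi_fun fP (f := Zero)) => -[]. Qed.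

Lemma fpi_F M N (P : forall s, M s -> N s -> Prop) i x y :
  finite_partial_iso P -> P None x y -> P (Some i) (fM i x) (fM i y).
Proof. by move=> fP xy; apply: (fpi_fun fP (f := Fsymb i)). Qed.

Lemma fpi_G M N (P : forall s, M s -> N s -> Prop) i c d :
  finite_partial_iso P -> P (Some i) c d -> P None (gM c) (gM d).
Proof. by move=> fP cd; apply: (fpi_fun fP (f := Gsymb i)). Qed.

Lemma fpi_lt M N (P : forall s, M s -> N s -> Prop) i :
  finite_partial_iso P -> order_preserving (@ltM M i) (@ltM N i) (P (Some i)).
Proof.
by move=> fP c c' d d' cd cd'; apply: (fpi_rel fP (r := i)) => j; case: ifP.
Qed.

Lemma order_preserving_eq T U (ltT : T -> T -> Prop) (ltU : U -> U -> Prop)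
    (R : T -> U -> Prop) a a' b b' :
  dlo ltT -> dlo ltU -> order_preserving ltT ltU R ->
  R a b -> R a' b' -> (a = a' <-> b = b').
Proof.
move=> dT dU Rlt ab ab'; have aa' := Rlt _ _ _ _ ab ab'.
have a'a := Rlt _ _ _ _ ab' ab; split=> [E|E].
  have [/aa'|[//|/a'a]] := dlo_total dU b b'; rewrite E => /(dlo_irrefl dT) //.
have [/aa'|[//|/a'a]] := dlo_total dT a a'; rewrite E => /(dlo_irrefl dU) //.
Qed.

(** Preservation of equality comes from the order. The unordered sort [R_0] is compared through one
    [f_i], available as [n] is positive, and recovered by [g_i]. *)
Lemma vo_finite_partial_iso M N (P : forall s, M s -> N s -> Prop) :
  (0 < n)%N -> vo_axioms M -> vo_axioms N ->
  P None (zM M) (zM N) ->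
  (forall i x y, P None x y -> P (Some i) (fM i x) (fM i y)) ->
  (forall i c d, P (Some i) c d -> P None (gM c) (gM d)) ->
  (forall i, order_preserving (@ltM M i) (@ltM N i) (P (Some i))) ->
  (forall s, finite_set [set p : M s * N s | P s p.1 p.2]) ->
  finite_partial_iso P.
Proof.
move=> n_gt0 MA NA P0 PF PG Plt Pfin; pose i0 := Ordinal n_gt0.
have Peq i (c c' : M (Some i)) (d d' : N (Some i)) :
    P _ c d -> P _ c' d' -> (c = c' <-> d = d').
  exact: order_preserving_eq (vo_dlo MA i) (vo_dlo NA i) (Plt i).
split=> //.
- case=> [|i|i] a b ab.
  + by rewrite !fun_interp_zero.
  + by rewrite !fun_interp_F; apply: PF; exact: ab.
  + by rewrite !fun_interp_G; apply: PG; exact: ab.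
- by move=> i a b ab; rewrite !rel_interp_lt; apply: Plt; exact: ab.
- case=> [i|] x x' y y' xy xy'; first exact: Peq xy xy'.
  have := Peq _ _ _ _ _ (PF i0 _ _ xy) (PF i0 _ _ xy') => E.
  split=> [H|H].
    rewrite -(vo_gf NA i0 y) -(vo_gf NA i0 y'); congr gM; apply/E.
    by rewrite H.
  rewrite -(vo_gf MA i0 x) -(vo_gf MA i0 x'); congr gM; apply/E.
  by rewrite H.
Qed.

Lemma finite_adjoin T U (R : T -> U -> Prop) a b :
  finite_set [set p : T * U | R p.1 p.2] ->
  finite_set [set p : T * U | R p.1 p.2 \/ p.1 = a /\ p.2 = b].
Proof.
move=> Rfin; apply: (@sub_finite_set _ _ ([set p | R p.1 p.2] `|` [set (a, b)])).
  by case=> c d /= [|[-> ->]]; [left|right].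
by rewrite finite_setU; split.
Qed.

(** In every [R_i] an interval is reserved for the image of [f_i a], and the box axiom finds one [b]
    for all of them. These intervals miss [f_i(F)], so [b] is outside [F]; this freedom serves the
    bound on [acl]. *)
Lemma vo_extend_base M N (P : forall s, M s -> N s -> Prop) (a : M None)
    (F : set (N None)) :
  (0 < n)%N -> vo_axioms M -> vo_axioms N -> finite_partial_iso P ->
  finite_set F -> (forall b, ~ P None a b) ->
  exists Q : forall s, M s -> N s -> Prop, finite_partial_iso Q /\
    (forall s c d, P s c d -> Q s c d) /\ exists b, Q None a b /\ ~ F b.
Proof.
move=> n_gt0 MA NA fP Ffin Pa.
have cut i : exists lr : N (Some i) * N (Some i), ltM lr.1 lr.2 /\
    forall d, ltM lr.1 d -> ltM d lr.2 ->
    order_preserving (@ltM M i) (@ltM N i)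
      (fun c' d' => P _ c' d' \/ c' = fM i a /\ d' = d) /\ ~ (fM i @` F) d.
  have [d ad|l [r lrP]] := dlo_cut (fM i (zM N)) (a := fM i a)
    (vo_dlo MA i) (vo_dlo NA i) (fpi_lt fP) (fpi_finite fP (Some i))
    (finite_image (fM i) Ffin); last by exists (l, r).
  (* If [f_i a] already had a partner, applying [g_i] would give [a] one as well. *)
  by apply: (Pa (gM d)); rewrite -[a](vo_gf MA i); exact: fpi_G.
pose lr i := sval (cid (cut i)).
have lrP i := svalP (cid (cut i)).
have [|b bP] := vo_f_box NA (a := fun i => (lr i).1) (b := fun i => (lr i).2).
  by move=> i; case: (lrP i).
have {}lrP i := (lrP i).2 (fM i b) (bP i).1 (bP i).2.
(* Adding [(a, b)] forces all pairs [(f_i a, f_i b)]; [g_i] sends them back to [(a, b)], so nothing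
   else is forced. *)
exists (fun s => match s return M s -> N s -> Prop with
  | None => fun c d => P None c d \/ c = a /\ d = b
  | Some i => fun c d => P (Some i) c d \/ c = fM i a /\ d = fM i b
  end); split; last first.
  split=> [[i|] c d cd|]; [by left|by left|exists b; split; first by right].
  by move=> Fb; have [_] := lrP (Ordinal n_gt0); apply; exists b.
apply: vo_finite_partial_iso => //.
- by left; exact: fpi_zero.
- by move=> i x y [xy|[-> ->]]; [left; exact: fpi_F|right].
- by move=> i c d [cd|[-> ->]]; [left; exact: fpi_G|right; rewrite !vo_gf].
- by move=> i; case: (lrP i).
- by case=> [i|]; apply: finite_adjoin; exact: fpi_finite.
Qed.

(** Co-density provides a [d] in the reserved interval outside the image of [f_i]. Then [g_i] sends
    [c] and [d] to 0, so adding the single pair [(c, d)] keeps the relation closed. *)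
Lemma vo_extend_nonimage M N (P : forall s, M s -> N s -> Prop) i (c : M (Some i))
    (F : set (N (Some i))) :
  (0 < n)%N -> vo_axioms M -> vo_axioms N -> finite_partial_iso P ->
  finite_set F -> (forall d, ~ P _ c d) -> (forall x, fM i x <> c) ->
  exists Q : forall s, M s -> N s -> Prop, finite_partial_iso Q /\
    (forall s c d, P s c d -> Q s c d) /\ exists d, Q _ c d /\ ~ F d.
Proof.
move=> n_gt0 MA NA fP Ffin Pc nc.
have [l [r [lr lrP]]] := dlo_cut (fM i (zM N)) (vo_dlo MA i) (vo_dlo NA i)
  (fpi_lt fP) (fpi_finite fP (Some i)) Ffin Pc.
have [d [nd [ld dr]]] := vo_f_codense NA lr.
have {lrP}[lrP Fd] := lrP d ld dr.
(* Comparing elements of the disjoint union adds a pair in sort [R_i] alone without casts between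
   sorts. *)
pose Q s (c' : M s) (d' : N s) := P s c' d' \/
  mkelt c' = mkelt c /\ mkelt d' = mkelt d.
have QSome c' d' : Q (Some i) c' d' -> P _ c' d' \/ c' = c /\ d' = d.
  by case=> [|[/mkelt_inj -> /mkelt_inj ->]]; [left|right].
have Qold s c' d' : s <> Some i -> Q s c' d' -> P s c' d'.
  by move=> si [//|[/(congr1 (@projT1 _ _))]].
exists Q; split; last first.
  by split=> [s c' d' cd'|]; [left|exists d; split=> //; right].
apply: vo_finite_partial_iso => //.
- by left; exact: fpi_zero.
- by move=> j x y /Qold xy; left; apply: fpi_F => //; exact: xy.
- move=> j c' d'; case: (eqVneq (Some j) (Some i)) => [[ji]|/eqP ji /(Qold _ _ _ ji) cd'].
    subst j; move=> /QSome[cd'|[-> ->]]; left; first exact: fpi_G.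
    by rewrite !vo_g_zero //; exact: fpi_zero.
  by left; exact: fpi_G.
- move=> j; case: (eqVneq (Some j) (Some i)) => [[ji]|/eqP ji].
    by subst j => c1 c2 d1 d2 /QSome cd1 /QSome cd2; exact: lrP.
  move=> c1 c2 d1 d2 /(Qold _ _ _ ji) cd1 /(Qold _ _ _ ji) cd2.
  exact: (fpi_lt fP).
- move=> s; case: (eqVneq s (Some i)) => [si|/eqP si].
    subst s; apply: sub_finite_set (finite_adjoin c d (fpi_finite fP (Some i))).
    by move=> -[c' d'] /QSome.
  apply: sub_finite_set (fpi_finite fP s).
  by move=> -[c' d'] /(Qold _ _ _ si).
Qed.

(** An element [f_i x] is handled by extending to [x], avoiding [g_i(F)]: if [f_i b] were in [F],
    then [b = g_i (f_i b)] would be in [g_i(F)]. *)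
Lemma vo_extend M N (P : forall s, M s -> N s -> Prop) s (a : M s) (F : set (N s)) :
  (0 < n)%N -> vo_axioms M -> vo_axioms N -> finite_partial_iso P ->
  finite_set F -> (forall b, ~ P s a b) ->
  exists Q : forall s, M s -> N s -> Prop, finite_partial_iso Q /\
    (forall s c d, P s c d -> Q s c d) /\ exists b, Q s a b /\ ~ F b.
Proof.
move=> n_gt0 MA NA fP; case: s a F => [i|] a F Ffin Pa; last exact: vo_extend_base.
have [[x xa]|nx] := pselect (exists x, fM i x = a); last first.
  by apply: vo_extend_nonimage => // x xa; apply: nx; exists x.
have [|y xy|Q [fQ [PQ [b [xb Fb]]]]] :=
    @vo_extend_base M N P x (@gM N i @` F) n_gt0 MA NA fP.
- exact: finite_image.
- by apply: (Pa (fM i y)); rewrite -xa; exact: fpi_F.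
exists Q; split=> //; split=> //; exists (fM i b); split.
  by rewrite -xa; exact: fpi_F.
by move=> Fb'; apply: Fb; exists (fM i b); rewrite ?vo_gf.
Qed.

Lemma vo_extension_property M N :
  (0 < n)%N -> vo_axioms M -> vo_axioms N -> extension_property M N.
Proof.
move=> n_gt0 MA NA P fP s a.
have [[b ab]|Pa] := pselect (exists b, P s a b).
  by exists P; split=> //; split=> //; exists b.
have [b ab|Q [fQ [PQ [b [ab _]]]]] :=
    vo_extend n_gt0 MA NA fP (finite_set0 (N s)) (a := a).
- by apply: Pa; exists b.
- by exists Q; split=> //; split=> //; exists b.
Qed.

(** ** Generated substructures, types and algebraic closure *)

(* In a model of VO_n the values of these terms, for variables in [X], form the
   substructure generated by the values of [X]: nested terms collapse because
   [g_i (f_i x) = x]. *)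
Definition basic_terms_base (X : set (var (Lstar n))) : set (@term (Lstar n) None) :=
  [set tzero n] `|` [set tvar0 n k | k in [set k | X (var0 n k)]] `|`
  \bigcup_(i in [set: 'I_n]) [set tG (tvari i k) | k in [set k | X (vari i k)]].

Definition basic_terms (X : set (var (Lstar n))) (s : option 'I_n) :
    set (@term (Lstar n) s) :=
  match s with
  | None => basic_terms_base X
  | Some i => [set tvari i k | k in [set k | X (vari i k)]] `|`
              [set tF i t | t in basic_terms_base X]
  end.

Lemma finite_basic_terms X s : finite_set X -> finite_set (@basic_terms X s).
Proof.
move=> Xfin.
have kfin (s' : option 'I_n) : finite_set [set k | X (s', k)].
  by apply: sub_finite_set (finite_image snd Xfin) => k Xk; exists (s', k).
have bfin : finite_set (basic_terms_base X).
  rewrite !finite_setU; split; first split.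
  - exact: finite_set1.
  - by apply: finite_image; exact: kfin.
  - by apply: bigcup_finite => // i _; apply: finite_image; exact: kfin.
case: s => [i|] //=; rewrite finite_setU; split; apply: finite_image => //.
exact: kfin.
Qed.

Lemma term_vars_basic_terms X s t : @basic_terms X s t -> term_vars t `<=` X.
Proof.
have base u : basic_terms_base X u -> term_vars u `<=` X.
  case=> [[->|[k Xk <-]]|[i _ [k Xk <-]]] y /=.
  - by case=> -[].
  - by move=> ->.
  - by case=> _ _ ->.
case: s t => [i|] t /=; last exact: base.
case=> [[k Xk <-]|[u /base uX <-]] y /=; first by move=> ->.
by case=> _ _ /uX.
Qed.

(** The candidate isomorphism between the substructures generated by the values of [X] under [v] and
    under [w], pairing the two values of each basic term. *)
Definition basic_relation (X : set (var (Lstar n))) M N (v : valuation M)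
    (w : valuation N) (s : Defs.sort (Lstar n)) (c : M s) (d : N s) : Prop :=
  exists t, @basic_terms X s t /\ c = eval v t /\ d = eval w t.

Lemma basic_relation_var X M N (v : valuation M) (w : valuation N) y :
  X y -> @basic_relation X M N v w y.1 (v y) (w y).
Proof.
case: y => -[i|] k Xk /=.
  by exists (tvari i k); split=> //; left; exists k.
by exists (tvar0 n k); split=> //; left; right; exists k.
Qed.

Lemma basic_relation_finite_partial_iso X M N (v : valuation M) (w : valuation N) :
  (0 < n)%N -> vo_axioms M -> vo_axioms N -> finite_set X ->
  (forall i t u, @basic_terms X (Some i) t -> @basic_terms X (Some i) u ->
     (ltM (eval v t) (eval v u) <-> ltM (eval w t) (eval w u))) ->
  finite_partial_iso (@basic_relation X M N v w).
Proof.
move=> n_gt0 MA NA Xfin vw; apply: vo_finite_partial_iso => //.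
- by exists (tzero n); rewrite !eval_tzero; split=> //; left; left.
- by move=> i _ _ [t [Xt [-> ->]]]; exists (tF i t); split=> //; right; exists t.
- move=> i _ _ [t [[[k Xk <-]|[u Xu <-]] [-> ->]]].
    by exists (tG (tvari i k)); split=> //; right; exists i => //; exists k.
  exists u; split; first exact: Xu.
  by rewrite !eval_tF !vo_gf.
- move=> i _ _ _ _ [t [Xt [-> ->]]] [u [Xu [-> ->]]]; exact: vw.
- move=> s; apply: sub_finite_set
    (finite_image (fun t => (eval v t, eval w t)) (finite_basic_terms s Xfin)).
  by move=> [c d] [t [Xt [/= -> ->]]]; exists t.
Qed.

(** * Quantifier elimination, uniqueness of the countable model, and closures *)

Lemma VO_quantifier_elimination : (0 < n)%N -> quantifier_elimination (@VO n).
Proof.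
move=> n_gt0; apply: back_and_forth_quantifier_elimination.
  by move=> M N /models_VO MA /models_VO NA; exact: vo_extension_property.
move=> X Xfin.
(* Finitely many order atoms between basic terms decide the type; equalities follow from them by
   totality. *)
pose Phi := \bigcup_(i in [set: 'I_n])
  [set vo_lt p.1 p.2 | p in @basic_terms X (Some i) `*` @basic_terms X (Some i)].
have /finite_set_listP[l lP] : finite_set Phi.
  apply: bigcup_finite => // i _; apply: finite_image; apply: finite_setX;
  exact: finite_basic_terms.
exists l; split=> [p /lP[i _ [[t u] /= [Xt Xu] <-]]|].
  split=> // y [j _ /=]; case: ifP => _; exact: term_vars_basic_terms.
move=> M v N w /models_VO MA /models_VO NA vw.
exists (@basic_relation X M N v w); split; last exact: basic_relation_var.
apply: basic_relation_finite_partial_iso => // i t u Xt Xu.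
have /lP/vw : Phi (vo_lt t u) by exists i => //; exists (t, u).
by rewrite /= !sat_lt.
Qed.

Lemma VO_unique_countable_model M N : (0 < n)%N ->
  models M (@VO n) -> ([set: elt M] #= [set: nat])%card ->
  models N (@VO n) -> ([set: elt N] #= [set: nat])%card ->
  isomorphic M N.
Proof.
move=> n_gt0 /models_VO MA Mc /models_VO NA Nc.
have [v] := valuation_inhabited M; have [w] := valuation_inhabited N.
apply: (@countable_isomorphic _ M N (@basic_relation set0 M N v w)) => //.
- exact: vo_extension_property.
- exact: vo_extension_property.
apply: basic_relation_finite_partial_iso => // i t u.
(* Without variables the only value in [R_i] is [f_i 0], so the initial relation preserves the order
   trivially. *)
have closed t' : @basic_terms set0 (Some i) t' -> forall K (z : valuation K),
    eval z t' = fM i (zM K).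
  case=> [[k []]|[t0 + <-] K z].
  case=> [[->|[k []]]|[j _ [k []]]].
  by rewrite eval_tF eval_tzero.
move=> /closed tE /closed uE; rewrite !tE !uE.
by split=> [/(dlo_irrefl (vo_dlo MA i))|/(dlo_irrefl (vo_dlo NA i))].
Qed.

(** If [a] is not generated by [A], the identity on the substructure generated by the parameters of
    [p] extends by a pair [(a, b)] with [b] outside the finite set [D]. Back and forth gives [b] the
    property defining [D], a contradiction. *)
Lemma acl_sub_generated M (A : set (elt M)) :
  (0 < n)%N -> vo_axioms M -> acl A `<=` generated A.
Proof.
move=> n_gt0 MA [s a] /= [D [[p [k [v [vA DE]]]] [Dfin Da]]].
apply: contrapT => nAa.
pose X := free_vars p `\ ((s, k) : var (Lstar n)).
have fP : finite_partial_iso (@basic_relation X M M v v).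
  apply: basic_relation_finite_partial_iso => //.
  by apply: finite_setD; exact: finite_free_vars.
have [b [t [Xt [/= at_ _]]]|Q [fQ [PQ [b [ab Db]]]]] :=
    vo_extend n_gt0 MA MA fP Dfin (a := a).
- apply: nAa; rewrite at_; apply: (generated_eval (t := t)) => y.
  by move=> /(term_vars_basic_terms Xt)[py ys]; exact: vA.
- apply: Db; rewrite DE /=; rewrite DE /= in Da.
  have MM := vo_extension_property n_gt0 MA MA.
  have vX := @basic_relation_var X M M v v.
  apply/(finite_partial_iso_sat MM MM fQ
    (@update_related _ M M _ Q (free_vars p) v v (s, k) a b PQ ab vX)).
  exact: Da.
Qed.

(* All function symbols have arity at most 1, so one variable suffices. *)
Lemma generated_one_variable M (A : set (elt M)) e : generated A e ->
  exists s (t : @term (Lstar n) s) (v : valuation M) y,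
    term_vars t `<=` [set y] /\
    (forall z, term_vars t z -> A (mkelt (v z))) /\ e = mkelt (eval v t).
Proof.
move: e; apply: smallest_sub; last first.
  move=> [s a] Aa; have [v] := valuation_inhabited M.
  exists s, (@Var (Lstar n) (s, 0)), (@update _ M v (s, 0) a), (s, 0).
  split=> //; split=> [z /= ->|/=]; rewrite ?(@update_same _ M v (s, 0) a) //.
have [v0] := valuation_inhabited M.
case=> [|i|i] a aA.
- exists None, (tzero n), v0, (var0 n 0); rewrite eval_tzero -(fun_interp_zero a).
  by split=> [y [[]]|]; [|split=> [y [[]]|]].
- have [s [t [v [y [ty [tA E]]]]]] := aA ord0.
  have sE : s = None by have := congr1 (@projT1 _ _) E.
  subst s; move/mkelt_inj: E => E.
  exists (Some i), (tF i t), v, y; split=> [z [_ _ /ty]//|].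
  by split=> [z [_ _ /tA]//|]; rewrite eval_tF -E fun_interp_F.
- have [s [t [v [y [ty [tA E]]]]]] := aA ord0.
  have sE : s = Some i by have := congr1 (@projT1 _ _) E.
  subst s; move/mkelt_inj: E => E.
  exists None, (tG t), v, y; split=> [z [_ _ /ty]//|].
  by split=> [z [_ _ /tA]//|]; rewrite eval_tG -E fun_interp_G.
Qed.

(** A generated element is the value of a term [t] with parameters in [A], hence is defined by an
    equation between a fresh variable and [t]. *)
Lemma generated_sub_dcl M (A : set (elt M)) : generated A `<=` dcl A.
Proof.
move=> e /generated_one_variable[s [t [v [y [ty [tA ->]]]]]].
(* All variables of [t] equal [y], so the next index is fresh whatever the sort. *)
pose k := y.2.+1.
have fresh z : term_vars t z -> (s, k) != z.
  by move=> /ty ->; apply/eqP => /(congr1 snd) /= /esym /n_Sn.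
exists (Equal (@Var (Lstar n) (s, k)) t), k, v; split=> [z /= [->//|/tA //]|].
apply/seteqP; split=> c /=; rewrite (@update_same _ M v (s, k) c).
  by move=> ->; apply: eval_ext => z /fresh zk; rewrite update_other.
move=> ->; apply: eval_ext => z /fresh zk; rewrite update_other //.
Qed.

(** The union is closed because each function symbol has at most one argument. Nonemptiness places
    the constant 0 in the union. *)
Lemma generated_bigcup M (A : set (elt M)) :
  A !=set0 -> generated A = \bigcup_(a in A) generated [set a].
Proof.
move=> [a0 Aa0]; apply/seteqP; split.
  apply: smallest_sub => [f|a Aa]; last by exists a => //; exact: sub_generated.
  case: f => [|i|i] a aA.
  - by exists a0 => //; apply: generated_substructure => -[].
  - have [b Ab ab] := aA ord0; exists b => //.
    by apply: generated_substructure => j; rewrite [j]ord1.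
  - have [b Ab ab] := aA ord0; exists b => //.
    by apply: generated_substructure => j; rewrite [j]ord1.
move=> e [a Aa]; apply: smallest_sub; first exact: generated_substructure.
by move=> _ ->; exact: sub_generated.
Qed.

(** ** A countable model *)

Lemma rat_dlo : dlo (fun a b : rat => (a < b)%R).
Proof.
split=> [a|a b c|a b|a b ab|a|a].
- by rewrite ltxx.
- exact: lt_trans.
- by have [ab|ab|->] := ltgtP a b; [left|right; right|right; left].
- by exists ((a + b) / 2%:R)%R; rewrite !midf_lt.
- by exists (a - 1)%R; rewrite ltrBlDr ltrDl.
- by exists (a + 1)%R; rewrite ltrDl.
Qed.

(** Greedy choice: the [k]-th interval is shrunk to avoid the finitely many points chosen before. *)
Lemma dlo_injective_selection T (lt : T -> T -> Prop) (I : nat -> T * T) :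
  dlo lt -> (forall k, lt (I k).1 (I k).2) ->
  exists e : nat -> T, injective e /\
    forall k, lt (I k).1 (e k) /\ lt (e k) (I k).2.
Proof.
move=> ltT Ilt.
have /choice[pick pickP] : forall sk : seq T * nat, exists x,
    (lt (I sk.2).1 x /\ lt x (I sk.2).2) /\ ~ List.In x sk.1.
  move=> [s k] /=.
  have [|l [r [lr H]]] := dlo_avoid (F := fun x => List.In x s) ltT _ (Ilt k).
    by apply/finite_set_listP; exists s.
  have [c [lc cr]] := dlo_dense ltT lr.
  by have [? [? ?]] := H c lc cr; exists c.
pose chosen := fix chosen k : seq T :=
  if k is k'.+1 then pick (chosen k', k') :: chosen k' else [::].
pose e k := pick (chosen k, k).
have e_chosen j k : (j < k)%N -> List.In (e j) (chosen k).
  elim: k => // k IHk; rewrite ltnS leq_eqVlt => /orP[/eqP ->|/IHk jk]; first by left.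
  by right.
exists e; split=> [j k ejk|k]; last exact: (pickP (chosen k, k)).1.
have [jk|kj|//] := ltngtP j k.
  by have [_] := pickP (chosen k, k); case; rewrite -/(e k) -ejk; exact: e_chosen.
by have [_] := pickP (chosen j, j); case; rewrite -/(e j) ejk; exact: e_chosen.
Qed.

(* The even terms of the selection enumerate points of all boxes, the odd ones
   keep a point of every interval out of the image. *)
Lemma generic_rat_sequences : exists F : 'I_n -> nat -> rat,
  (forall i, injective (F i)) /\
  (forall i (a b : rat), (a < b)%R ->
     exists c, (forall x, F i x <> c) /\ (a < c)%R /\ (c < b)%R) /\
  (forall a b : 'I_n -> rat, (forall i, (a i < b i)%R) ->
     exists x, forall i, (a i < F i x)%R /\ (F i x < b i)%R).
Proof.
(* Codes of pairs that are not increasing are replaced by the interval from 0 to 1, so every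
   interval of the list is nonempty. *)
pose proper (p : rat * rat) := if (p.1 < p.2)%R then p else (0%R, 1%R).
have properP p : ((proper p).1 < (proper p).2)%R.
  by rewrite /proper; case: ifP => //= _; exact: ltr01.
pose box k (i : 'I_n) : rat * rat := if unpickle k is Some B
  then (B : {ffun 'I_n -> rat * rat}) i else (0%R, 1%R).
pose itv k : rat * rat := if unpickle k is Some p then p else (0%R, 1%R).
pose I i k := proper (if odd k then itv k./2 else box k./2 i).
have /choice[e eP] : forall i, exists e : nat -> rat, injective e /\
    forall k, ((I i k).1 < e k)%R /\ (e k < (I i k).2)%R.
  by move=> i; exact: (dlo_injective_selection rat_dlo (fun k => properP _)).
exists (fun i k => e i k.*2); split; [|split].
- by move=> i j k /(eP i).1 /double_inj.
- move=> i a b ab.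
  have [m mE] : exists m, unpickle m = Some (a, b).
    by exists (pickle (a, b)); exact: pickleK.
  (* Injectivity of [e i] separates this odd term from all even terms, which make up the image. *)
  exists (e i m.*2.+1); split.
    by move=> x /(eP i).1 /(congr1 odd); rewrite /= !odd_double.
  have := (eP i).2 m.*2.+1.
  by rewrite /I /= odd_double /= uphalf_double /itv mE /proper /= ab.
- move=> a b ab; pose B := [ffun i => (a i, b i)].
  have [m mE] : exists m, unpickle m = Some B.
    by exists (pickle B); exact: pickleK.
  (* The code [m] names a box in all coordinates, so one index works for every [i]. *)
  exists m => i; have := (eP i).2 m.*2.
  by rewrite /I odd_double doubleK /box mE ffunE /proper /= ab.
Qed.

Definition rat_carrier (s : option 'I_n) : Type := if s is Some _ then rat else nat.

Lemma rat_carrier_inhabited s : inhabited (rat_carrier s).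
Proof. by case: s => [i|]; constructor; [exact: 0%R|exact: 0%N]. Qed.

(** The sort [R_0] is [nat] with constant 0, each [R_i] is [rat], and [g_i] selects a preimage with
    default value 0. *)
Definition rat_model (F : 'I_n -> nat -> rat) : structure (Lstar n) :=
  @Structure (Lstar n) rat_carrier rat_carrier_inhabited
    (fun f => match f return
         (forall j : 'I_(vo_fun_arity f), rat_carrier (@vo_fun_dom n f j)) ->
         rat_carrier (vo_fun_cod f) with
       | Zero => fun=> 0%N
       | Fsymb i => fun a => F i (a ord0)
       | Gsymb i => fun a => xget 0%N [set x | F i x = a ord0]
       end)
    (fun i a => ((a ord0 : rat) < (a ord_max : rat))%R).

Lemma VO_countable_model :
  exists M : structure (Lstar n), models M (@VO n) /\
    ([set: elt M] #= [set: nat])%card.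
Proof.
have [F [Finj [Fcodense Fbox]]] := generic_rat_sequences.
exists (rat_model F); split.
  apply/models_VO; split.
  - move=> i; exact: rat_dlo.
  - move=> i x; apply: (Finj i); exact: (@xgetI _ 0%N [set y | F i y = F i x] x).
  - move=> i c nc; apply: xgetPN => x; exact: nc.
  - move=> i a b ab.
    (* Density of a single image is the box property with the interval from 0 to 1 in the other
       coordinates. *)
    have [|x xP] := Fbox (fun j => if j == i then a else 0%R)
      (fun j => if j == i then b else 1%R).
      by move=> j; case: ifP => // _; exact: ltr01.
    by exists x; have := xP i; rewrite eqxx.
  - by move=> i a b ab; exact: Fcodense.
  - by move=> a b ab; exact: Fbox.
apply: eq_card_nat.
  apply/countable_injP; exists (fun e => pickle (match e with
    | existT None k => (None, k, 0%R)
    | existT (Some i) q => (Some i, 0%N, q)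
    end : option 'I_n * nat * rat)).
  move=> e e' _ _ /(pcan_inj pickleK).
  by case: e e' => [[i|] q] [[j|] r] //= [] *; subst.
(* Finitely many elements would leave only finitely many in [R_0], which is [nat]. *)
move=> /(finite_image (fun e : elt (rat_model F) =>
  if e is existT None k then k else 0%N)) fin; apply: infinite_nat.
apply: sub_finite_set fin => k _.
by exists (@mkelt (Lstar n) (rat_model F) None k).
Qed.

End VO.

Theorem theorem3p3 (n : nat) (hn : (1 <= n)%N) :
  aleph0_categorical (@VO n) /\
  quantifier_elimination (@VO n) /\
  (forall (M : structure (Lstar n)), models M (@VO n) ->
     forall A : set (elt M),
       acl A = dcl A /\
       dcl A = generated A /\
       (A !=set0 -> generated A = \bigcup_(a in A) generated [set a])).
Proof.
split; [|split].
- split; first exact: VO_countable_model.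
  by move=> M N; exact: VO_unique_countable_model.
- exact: VO_quantifier_elimination.
move=> M /models_VO MA A.
(* The equalities close the cycle of inclusions from [acl A] to [generated A] to [dcl A] and back to
   [acl A]. *)
have dcl_generated : dcl A = generated A.
  apply/seteqP; split; last exact: generated_sub_dcl.
  by move=> a /dcl_sub_acl; exact: acl_sub_generated.
split; last by split=> //; exact: generated_bigcup.
apply/seteqP; split; last exact: dcl_sub_acl.
by rewrite dcl_generated; exact: acl_sub_generated.
Qed.
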